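(* There exists an absolute constant $C>0$ (and an absolute constant $K>0$) such that the following holds. Let $d \ge C$ and $n \ge C d^3$. There exists a matrix $X\in\mathbb R^{n\times d}$ with nonzero rows $x_1,\dots,x_n$ and a top right-singular vector $u$ of $X$ such that: (1) $\frac1n\sum_{i=1}^n \langle x_i, u\rangle^4 \le K$; (2) $\frac1n\sum_{i=1}^n \langle x_i, \bar x_j\rangle^4 \le K$ for all $j = 1,\dots,n$, where $\bar x_j = x_j/\|x_j\|_2$; (3) there exists a unit vector $v\in\mathbb R^d$ such that $\frac1n\sum_{i=1}^n\langle x_i, v\rangle^4 \ge d$.
   Context: A top right-singular vector of $X$ is a unit vector $u$ maximizing $\|Xu\|_2$ over unit vectors (a top eigenvector of $X^\top X$). Norms are Euclidean. *)

(* Defs.v *)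
From HB Require Import structures.
From mathcomp Require Import all_boot all_order all_algebra reals.

Set Implicit Arguments.
Unset Strict Implicit.
Unset Printing Implicit Defensive.

Import Order.TTheory GRing.Theory Num.Theory.
Local Open Scope ring_scope.

Definition dotv (R : realType) (m : nat) (x y : 'cV[R]_m) : R :=
  \sum_(k < m) x k 0 * y k 0.

(* The Euclidean norm; MathComp-Analysis' `|x| on matrices is the sup norm. *)
Definition norm2 (R : realType) (m : nat) (x : 'cV[R]_m) : R :=
  Num.sqrt (dotv x x).

Definition unit_vector (R : realType) (m : nat) (x : 'cV[R]_m) : Prop :=
  norm2 x = 1.

Definition normalize (R : realType) (m : nat) (x : 'cV[R]_m) : 'cV[R]_m :=
  (norm2 x)^-1 *: x.

Definition rowv (R : realType) (n d : nat) (X : 'M[R]_(n, d)) (i : 'I_n) :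
  'cV[R]_d := (row i X)^T.

Definition top_right_singular_vector (R : realType) (n d : nat)
    (X : 'M[R]_(n, d)) (u : 'cV[R]_d) : Prop :=
  unit_vector u /\
  forall w : 'cV[R]_d, unit_vector w -> norm2 (X *m w) <= norm2 (X *m u).

Definition fourth_moment (R : realType) (n d : nat) (X : 'M[R]_(n, d))
    (w : 'cV[R]_d) : R :=
  n%:R^-1 * \sum_(i < n) dotv (rowv X i) w ^+ 4.

(* Main.v *)
(** Let [F] be a finite field with [q] elements, where [q ^ 2] is of order [d].
    Use [F * F] together with one extra point [None] as coordinates.  The
    [q ^ 4] special rows are [b] times the indicators of the graphs of the
    polynomials of degree at most 3 over [F], with [b ^ 4 = d n / q ^ 4]; all
    the other rows are the basis vector [u] of the extra coordinate.  The flat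
    vector [v = 1 / q] on [F * F] has inner product [b] with each special row,
    so its fourth moment is [d].  Two distinct graphs meet in at most 3 points,
    so the fourth moment along the direction of a special row is at most
    [82 d / q ^ 2].  By Cauchy-Schwarz the special rows contribute at most
    [b ^ 2 q ^ 4 = q ^ 2 sqrt (d n)] to [|X w| ^ 2]; as [n >= C d ^ 3] this is
    below the number of other rows, which makes [u] a top right-singular
    vector. *)
Require Import Defs.
From mathcomp Require Import all_boot all_order all_algebra reals.
From mathcomp Require Import finfield ring lra zify.
Set Implicit Arguments.
Unset Strict Implicit.
Unset Printing Implicit Defensive.

Import Order.TTheory GRing.Theory Num.Theory.
Local Open Scope ring_scope.

(** * Sums over padded lists, and Cauchy-Schwarz *)

Lemma sum_nth (R : realType) (U : Type) (x0 : U) (s : seq U) (n : nat)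
    (H : U -> R) : (size s <= n)%N ->
  \sum_(i < n) H (nth x0 s i) =
  \sum_(x <- s) H x + (n - size s)%:R * H x0.
Proof.
move=> sn.
rewrite -(big_mkord xpredT (fun i => H (nth x0 s i))).
rewrite (big_cat_nat (n := size s)) //= -(big_nth x0 xpredT); congr (_ + _).
rewrite big_nat (eq_bigr (fun=> H x0)); last first.
  by move=> i /andP[si _]; rewrite nth_default.
by rewrite -big_nat sumr_const_nat mulr_natl.
Qed.

Lemma sqr_sum_le (R : realType) (I : finType) (a : I -> R) :
  (\sum_i a i) ^+ 2 <= #|I|%:R * \sum_i a i ^+ 2.
Proof.
have h i j : a i * a j <= (a i ^+ 2 + a j ^+ 2) / 2.
  have := sqr_ge0 (a i - a j); nra.
rewrite expr2 big_distrlr /=.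
apply: le_trans (ler_sum _ (fun i _ => ler_sum _ (fun j _ => h i j))) _.
have step i : \sum_j (a i ^+ 2 + a j ^+ 2) / 2 =
    (a i ^+ 2 *+ #|I| + \sum_j a j ^+ 2) / 2.
  by rewrite -mulr_suml big_split /= sumr_const.
rewrite (eq_bigr _ (fun i _ => step i)) -mulr_suml big_split /= sumr_const.
by rewrite sumrMnl -(mulr_natl _ #|I|); lra.
Qed.

(** * The Euclidean inner product *)

Section DotProduct.
Variables (R : realType) (m : nat).
Implicit Types x y : 'cV[R]_m.

Lemma dotvZl (c : R) x y : dotv (c *: x) y = c * dotv x y.
Proof. by rewrite /dotv mulr_sumr; apply: eq_bigr => k _; rewrite mxE mulrA. Qed.

Lemma dotvC x y : dotv x y = dotv y x.
Proof. by apply: eq_bigr => k _; rewrite mulrC. Qed.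

Lemma dotvZr (c : R) x y : dotv x (c *: y) = c * dotv x y.
Proof. by rewrite dotvC dotvZl dotvC. Qed.

Lemma dotv0l y : dotv 0 y = 0.
Proof. by rewrite -(scale0r 0) dotvZl mul0r. Qed.

Lemma dotv_ge0 x : 0 <= dotv x x.
Proof. by apply: sumr_ge0 => k _; rewrite -expr2 sqr_ge0. Qed.

Lemma unit_vectorP x : unit_vector x <-> dotv x x = 1.
Proof.
rewrite /unit_vector /norm2; split=> [h|->]; last exact: sqrtr1.
by rewrite -(sqr_sqrtr (dotv_ge0 x)) h expr1n.
Qed.

Lemma norm2_sqr x : norm2 x ^+ 2 = dotv x x.
Proof. exact/sqr_sqrtr/dotv_ge0. Qed.

End DotProduct.

(** * Matrices whose rows are a list padded by one vector *)

Section RowList.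
Variables (R : realType) (n d : nat) (e : 'cV[R]_d) (s : seq 'cV[R]_d).
Hypothesis sn : (size s <= n)%N.

(** The default value of [nth] does the padding: after the entries of [s], the remaining
    [n - size s] rows are all [e]. *)
Definition rows_mx : 'M[R]_(n, d) := \matrix_(i, k) nth e s i k 0.

Lemma rowv_rows_mx i : rowv rows_mx i = nth e s i.
Proof. by apply/colP => k; rewrite !mxE. Qed.

Lemma rows_mx_ind (P : 'cV[R]_d -> Prop) :
  P e -> (forall x, x \in s -> P x) -> forall i, P (rowv rows_mx i).
Proof.
move=> Pe Ps i; rewrite rowv_rows_mx.
by have [is_|si] := ltnP i (size s); [apply/Ps/mem_nth|rewrite nth_default].
Qed.

Lemma fourth_moment_rows_mx w :
  fourth_moment rows_mx w =
  n%:R^-1 * (\sum_(x <- s) dotv x w ^+ 4 + (n - size s)%:R * dotv e w ^+ 4).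
Proof.
rewrite /fourth_moment -(sum_nth e (fun x => dotv x w ^+ 4)) //.
by under eq_bigr do rewrite rowv_rows_mx.
Qed.

Lemma dotv_rows_mx w :
  dotv (rows_mx *m w) (rows_mx *m w) =
  \sum_(x <- s) dotv x w ^+ 2 + (n - size s)%:R * dotv e w ^+ 2.
Proof.
rewrite -(sum_nth e (fun x => dotv x w ^+ 2)) //; apply: eq_bigr => i _.
rewrite -expr2 mxE; congr (_ ^+ 2).
by apply: eq_bigr => k _; rewrite mxE.
Qed.

End RowList.

(** * Vectors supported on an embedded set of coordinates *)

Section Embedding.
Variables (R : realType) (S : finType) (d : nat) (pos : S -> 'I_d).
Hypothesis pos_inj : injective pos.

(** Coordinates outside the image of [pos] are zero, so [d] may exceed the size of [S]. *)
Definition embed (h : S -> R) : 'cV[R]_d :=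
  \sum_s h s *: delta_mx (pos s) 0.

Lemma dotv_embed h w : dotv (embed h) w = \sum_s h s * w (pos s) 0.
Proof.
rewrite /dotv.
under eq_bigr do rewrite summxE big_distrl /=.
rewrite exchange_big /=; apply: eq_bigr => s _.
rewrite (bigD1 (pos s)) //= big1 => [|k /negPf ks].
  by rewrite !mxE !eqxx addr0 mulr1.
by rewrite !mxE ks mulr0 mul0r.
Qed.

Lemma embedE h s : embed h (pos s) 0 = h s.
Proof.
rewrite summxE (bigD1 s) //= big1 => [|t /negPf ts].
  by rewrite !mxE !eqxx addr0 mulr1.
by rewrite !mxE (inj_eq pos_inj) eq_sym ts mulr0.
Qed.

Lemma dotv_embed2 h h' : dotv (embed h) (embed h') = \sum_s h s * h' s.
Proof. by rewrite dotv_embed; under eq_bigr do rewrite embedE. Qed.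

Lemma sum_sqr_pos_le (w : 'cV[R]_d) :
  \sum_s w (pos s) 0 ^+ 2 <= dotv w w.
Proof.
rewrite -(big_imset (fun k => w k 0 ^+ 2)) /=; last by move=> s t _ _ /pos_inj.
rewrite /dotv [leRHS](bigID [in [set pos s | s : S]]) /=.
under [X in _ <= X + _]eq_bigr do rewrite -expr2.
by rewrite lerDl; apply: sumr_ge0 => k _; rewrite -expr2 sqr_ge0.
Qed.

End Embedding.

Lemma sum_option (R : realType) (S : finType) (g : option S -> R) :
  \sum_s g s = g None + \sum_s g (Some s).
Proof.
rewrite (bigD1 None) //=; congr (_ + _).
rewrite -(big_imset (h := Some) g) /=; last by move=> s t _ _ [].
apply: eq_bigl => -[s|]; first by rewrite imset_f.
by apply/esym/imsetP => -[].
Qed.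

Lemma sum_pair (R : realType) (S T : finType) (g : S * T -> R) :
  \sum_p g p = \sum_x \sum_y g (x, y).
Proof. by rewrite pair_bigA; apply: eq_bigr => -[]. Qed.

(** * Indicators of graphs of functions *)

Section Graph.
Variables (R : realType) (F : finType).

Definition graph_ind (f : F -> F) (s : option (F * F)) : R :=
  if s is Some p then (p.2 == f p.1)%:R else 0.

Lemma sum_graph_ind f (g : option (F * F) -> R) :
  \sum_s graph_ind f s * g s = \sum_x g (Some (x, f x)).
Proof.
rewrite sum_option mul0r add0r sum_pair.
apply: eq_bigr => x _; rewrite (bigD1 (f x)) //= eqxx /= mul1r big1 ?addr0 //.
by move=> y /negPf ->; rewrite mul0r.
Qed.

End Graph.

(** * Polynomials of degree at most 3 over a finite field *)

Section Cubic.
Variable F : finFieldType.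

(** The constant coefficient is kept apart so that it can be varied alone in [sum_cubic]. *)
Definition cubic : finType := (F * 3.-tuple F)%type.

Definition cubic_poly (t : cubic) : {poly F} := Poly (t.1 :: t.2).

Definition cubic_fun (t : cubic) (x : F) : F := (cubic_poly t).[x].

Lemma card_cubic : #|cubic| = (#|F| ^ 4)%N.
Proof. by rewrite card_prod card_tuple -expnS. Qed.

Lemma cubic_poly_inj : injective cubic_poly.
Proof.
move=> [c s] [c' s'] e.
have h i : (c :: s)`_i = (c' :: s')`_i.
  by move: (congr1 (fun p : {poly F} => p`_i) e); rewrite !coef_Poly.
congr (_, _); first exact: h 0%N.
apply: eq_from_tnth => i; rewrite !(tnth_nth 0); exact: h i.+1.
Qed.

(** Agreement points are roots of the difference, a nonzero polynomial of degree at most 3. *)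
Lemma cubic_agree t t' : t != t' ->
  (#|[set x | cubic_fun t x == cubic_fun t' x]| <= 3)%N.
Proof.
move=> tt'; set p := cubic_poly t - cubic_poly t'.
have p0 : p != 0 by rewrite subr_eq0 (inj_eq cubic_poly_inj).
have sp : (size p <= 4)%N.
  rewrite (leq_trans (size_polyD _ _)) // geq_max size_polyN.
  by rewrite !(leq_trans (size_Poly _)) //= size_tuple.
rewrite -ltnS cardE (leq_trans _ sp) // max_poly_roots ?enum_uniq //.
by apply/allP => x; rewrite mem_enum inE /root hornerD hornerN subr_eq0.
Qed.

(** Once the three higher coefficients are fixed, the value at [x] is a translate of the constant
    coefficient, hence runs once through [F]. *)
Lemma sum_cubic (R : realType) (x : F) (g : F -> R) :
  \sum_t g (cubic_fun t x) = (#|F| ^ 3)%:R * \sum_y g y.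
Proof.
rewrite sum_pair exchange_big /= (eq_bigr (fun=> \sum_y g y)) => [|s _].
  by rewrite sumr_const card_tuple mulr_natl.
rewrite [RHS](reindex_inj (addrI (horner_rec s x * x))) /=.
by apply: eq_bigr => c _; rewrite /cubic_fun /cubic_poly horner_Poly.
Qed.

End Cubic.

(** * The vectors of the construction and their inner products *)

Section Construction.
Variables (R : realType) (F : finFieldType) (d : nat).
Variable pos : option (F * F) -> 'I_d.
Hypothesis pos_inj : injective pos.

Let q : R := #|F|%:R.

Definition graph_vec (t : cubic F) : 'cV[R]_d :=
  embed pos (graph_ind R (cubic_fun t)).

Definition extra_vec : 'cV[R]_d := embed pos (fun s => (s == None)%:R).

Definition flat_vec : 'cV[R]_d :=
  embed pos (fun s => if s is Some _ then q^-1 else 0).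

Lemma q_gt0 : 0 < q.
Proof. by rewrite ltr0n; apply/card_gt0P; exists 0. Qed.

Lemma dotv_graph_vec t w :
  dotv (graph_vec t) w = \sum_x w (pos (Some (x, cubic_fun t x))) 0.
Proof. by rewrite dotv_embed (sum_graph_ind _ (fun s => w (pos s) 0)). Qed.

Lemma dotv_extra_vec w : dotv extra_vec w = w (pos None) 0.
Proof.
rewrite dotv_embed sum_option /= mul1r big1 ?addr0 // => s _.
by rewrite mul0r.
Qed.

Lemma dotv_graph_extra t : dotv (graph_vec t) extra_vec = 0.
Proof. by rewrite dotv_graph_vec big1 // => x _; rewrite embedE. Qed.

Lemma dotv_extra_extra : dotv extra_vec extra_vec = 1.
Proof. by rewrite dotv_extra_vec embedE. Qed.

Lemma dotv_extra_graph t : dotv extra_vec (graph_vec t) = 0.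
Proof. by rewrite dotvC dotv_graph_extra. Qed.

Lemma dotv_graph_flat t : dotv (graph_vec t) flat_vec = 1.
Proof.
rewrite dotv_graph_vec.
under eq_bigr do rewrite embedE //.
by rewrite sumr_const -mulr_natl mulfV // gt_eqF // q_gt0.
Qed.

Lemma unit_flat_vec : unit_vector flat_vec.
Proof.
apply/unit_vectorP; rewrite dotv_embed2 // sum_option mul0r add0r.
rewrite sumr_const card_prod -mulr_natl natrM mulrACA.
by rewrite mulfV ?mulr1 // gt_eqF // q_gt0.
Qed.

Lemma dotv_graph_graph t t' :
  dotv (graph_vec t) (graph_vec t') =
  #|[set x | cubic_fun t x == cubic_fun t' x]|%:R.
Proof.
rewrite dotv_graph_vec.
under eq_bigr do rewrite embedE //=.
by rewrite -natr_sum -big_mkcond /= sum1dep_card cardsE.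
Qed.

Lemma dotv_graph_diag t : dotv (graph_vec t) (graph_vec t) = q.
Proof.
rewrite dotv_graph_graph; congr _%:R.
by apply: eq_card => x; rewrite inE eqxx.
Qed.

(** The diagonal term is [q ^ 4], and each of the fewer than [q ^ 4] others is at most 3 ^ 4 = 81.
    Degree 3 makes both contributions of the same order. *)
Lemma sum_dotv_graph4_le t' :
  \sum_t dotv (graph_vec t) (graph_vec t') ^+ 4 <= 82 * q ^+ 4.
Proof.
rewrite (bigD1 t') //= dotv_graph_diag.
have h t : t != t' -> dotv (graph_vec t) (graph_vec t') ^+ 4 <= 81.
  move=> tt'; rewrite dotv_graph_graph -natrX ler_nat.
  by rewrite (@leq_exp2r _ 3 4) // cubic_agree.
rewrite -[82]/(81 + 1)%:R natrD mulrDl mul1r addrC lerD2r.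
apply: le_trans (ler_sum _ h) _; rewrite sumr_const -[leLHS]mulr_natr ler_wpM2l //.
rewrite /q -natrX ler_nat -card_cubic.
exact: max_card.
Qed.

(* Through each point of [F * F] there pass [#|F| ^ 3] graphs. *)
Lemma sum_dotv_graph2_le w :
  \sum_t dotv (graph_vec t) w ^+ 2 <= q ^+ 4 * (dotv w w - w (pos None) 0 ^+ 2).
Proof.
pose W x y := w (pos (Some (x, y))) 0 ^+ 2.
apply: (@le_trans _ _ (\sum_t q * \sum_x W x (cubic_fun t x))).
  by apply: ler_sum => t _; rewrite dotv_graph_vec sqr_sum_le.
rewrite -mulr_sumr exchange_big /=.
rewrite (eq_bigr _ (fun x _ => sum_cubic x (W x))) -mulr_sumr natrX.
rewrite mulrA -exprS ler_wpM2l ?exprn_ge0 ?ler0n //.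
have := sum_sqr_pos_le pos_inj w.
by rewrite sum_option sum_pair lerBrDl.
Qed.

End Construction.

(** * Choice of parameters and verification *)

Lemma dotv_normalize4 (R : realType) (m : nat) (x y : 'cV[R]_m) :
  dotv x (normalize y) ^+ 4 = (dotv y y ^+ 2)^-1 * dotv x y ^+ 4.
Proof.
by rewrite dotvZr exprMn exprVn -norm2_sqr -exprM.
Qed.

Theorem theoremA1 (R : realType) :
  exists C K : R, 0 < C /\ 0 < K /\
    forall d n : nat, C <= d%:R -> C * d%:R ^+ 3 <= n%:R ->
    exists (X : 'M[R]_(n, d)) (u : 'cV[R]_d),
      (forall i : 'I_n, rowv X i <> 0) /\
      top_right_singular_vector X u /\
      fourth_moment X u <= K /\
      (forall j : 'I_n, fourth_moment X (normalize (rowv X j)) <= K) /\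
      (exists v : 'cV[R]_d, unit_vector v /\ d%:R <= fourth_moment X v).
Proof.
(* 328 = 4 * 82, from [d <= 4 * q ^ 2] and the constant of [sum_dotv_graph4_le]. *)
exists 5, 328; do 2 split=> //.
move=> d n; rewrite ler_nat -natrX -natrM ler_nat => d5 nd.
have d1 : (0 < d.-1)%N by lia.
(* The largest power 4 ^ k below [d] gives a field of order 2 ^ k with [q ^ 2 < d <= 4 * q ^ 2]; the
   strict inequality leaves room for the extra coordinate, and [d >= 5] ensures [k > 0]. *)
have /andP[lo hi] := trunc_log_bounds (isT : 1 < 4)%N d1.
set k := trunc_log 4 d.-1 in lo hi *.
have k0 : (0 < k)%N by rewrite trunc_log_gt0 /=; lia.
have [F _ cF] := pPrimePowerField (isT : prime 2) k0.
have cF2 : (#|F| ^ 2 = 4 ^ k)%N by rewrite cF -expnM mulnC expnM.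
have qd : (#|F| ^ 2 < d)%N by lia.
have dq : (d <= 4 * #|F| ^ 2)%N by rewrite cF2 -expnS; lia.
have sd : (#|{: option (F * F)}| <= d)%N.
  by rewrite card_option card_prod mulnn.
pose pos s : 'I_d := widen_ord sd (enum_rank s).
have pos_inj : injective pos.
  by move=> s t /(congr1 val) /= /val_inj /enum_rank_inj.
pose q : R := #|F|%:R.
have q0 : 0 < q by exact: q_gt0.
have n0 : 0 < n%:R :> R by rewrite ltr0n; nia.
pose r : R := Num.sqrt (d%:R * n%:R).
have r2 : r ^+ 2 = d%:R * n%:R by rewrite sqr_sqrtr // -natrM.
have r0 : 0 < r by rewrite sqrtr_gt0 -natrM ltr0n; nia.
pose b : R := Num.sqrt r / q.
have b2 : b ^+ 2 = r / q ^+ 2 by rewrite exprMn exprVn sqr_sqrtr // ltW.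
have b4 : b ^+ 4 * q ^+ 4 = d%:R * n%:R.
  rewrite (exprM b 2 2) b2 exprMn exprVn -exprM r2 divfK //.
  by rewrite expf_neq0 // gt_eqF.
have b0 : 0 < b by rewrite divr_gt0 // sqrtr_gt0.
clearbody b.
pose g := @graph_vec R F d pos.
pose e := extra_vec R pos.
pose s := [seq b *: g t | t : cubic F].
have ss : size s = (#|F| ^ 4)%N by rewrite size_map -cardE card_cubic.
have sn : (size s <= n)%N by rewrite ss; nia.
have sumE (h : 'cV[R]_d -> R) : \sum_(x <- s) h x = \sum_t h (b *: g t).
  by rewrite big_image.
pose N : R := (n - size s)%:R.
have Nn : N <= n%:R by rewrite ler_nat leq_subr.
(* At least half of the rows are [e], since [q ^ 4 <= d ^ 2] is small against [n]. *)
have nN : n%:R <= 2 * N by rewrite -natrM ler_nat ss; nia.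
(* The left side is [r * q ^ 2 <= r * d], and [5 * (r * d) ^ 2 = 5 * d ^ 3 * n <= n ^ 2 <= 4 * N ^
   2]. *)
have bN : b ^+ 2 * q ^+ 4 <= N.
  rewrite b2 (exprD q 2 2) mulrA divfK ?expf_neq0 ?gt_eqF //.
  have qd' : q ^+ 2 <= d%:R by rewrite -natrX ler_nat ltnW.
  have rd : (r * d%:R) ^+ 2 * 5 <= n%:R ^+ 2.
    by rewrite exprMn r2 -!(natrX, natrM) ler_nat; nia.
  have rd0 : 0 <= r * d%:R by rewrite mulr_ge0 // ltW.
  apply: le_trans (_ : r * d%:R <= _); first by rewrite ler_wpM2l // ltW.
  nra.
have graph_extra0 p : \sum_t dotv (b *: g t) e ^+ p.+1 = 0.
  rewrite big1 // => t _.
  by rewrite dotvZl dotv_graph_extra // mulr0 expr0n.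
have ue : dotv e e = 1 by exact: dotv_extra_extra.
have fm := fourth_moment_rows_mx _ sn.
exists (rows_mx n e s), e; split; [|split; [|split; [|split]]].
- apply: (@rows_mx_ind _ _ _ _ _ (fun x => x <> 0)) => [|x /imageP[t _ ->]] /(congr1 (fun x => dotv x x)).
    by rewrite dotv0l ue => /eqP; rewrite oner_eq0.
  rewrite dotv0l dotvZl dotvZr dotv_graph_diag // => /eqP.
  by rewrite -/q !mulf_eq0 (gt_eqF b0) (gt_eqF q0).
(* With [y] the squared extra coordinate of [w], the squared norm of the image of [w] is at most
   [b ^ 2 * q ^ 4 * (1 - y) + N * y <= N], the value at [e]. *)
- split=> [|w /unit_vectorP w1]; first exact/unit_vectorP.
  rewrite ler_wsqrtr // !dotv_rows_mx // !sumE graph_extra0 ue -/N.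
  under eq_bigr do rewrite dotvZl exprMn.
  rewrite -mulr_sumr dotv_extra_vec.
  have := sum_dotv_graph2_le pos_inj w; rewrite w1 -/g -/q.
  have := sum_sqr_pos_le pos_inj w; rewrite w1 sum_option.
  set y := w (pos None) 0 ^+ 2; set Z := \sum_s _; set S := \sum_t _ => hy hS.
  have y1 : 0 <= 1 - y.
    have : 0 <= Z by apply: sumr_ge0 => p _; apply: sqr_ge0.
    lra.
  have h1 : b ^+ 2 * S <= b ^+ 2 * (q ^+ 4 * (1 - y)).
    by rewrite ler_wpM2l // sqr_ge0.
  have h2 : b ^+ 2 * q ^+ 4 * (1 - y) <= N * (1 - y) by rewrite ler_wpM2r.
  lra.
- rewrite fm sumE graph_extra0 ue -/N mulrC ler_pdivrMr //.
  by lra.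
- apply: (@rows_mx_ind _ _ _ _ _ (fun x => fourth_moment _ (normalize x) <= 328)).
    rewrite fm sumE -/N.
    under eq_bigr do rewrite dotv_normalize4 ue expr1n invr1 mul1r.
    rewrite graph_extra0 dotv_normalize4 ue mulrC ler_pdivrMr //.
    by lra.
  move=> x /imageP[t _ ->]; rewrite fm sumE -/N.
  have eg : dotv e (b *: g t) = 0 by rewrite dotvZr dotv_extra_graph ?mulr0.
  rewrite dotv_normalize4 eg expr0n /= !mulr0 addr0 mulrC ler_pdivrMr //.
  (* Normalizing divides by [(b ^ 2 * q) ^ 2], so the sum is at most
     [82 * b ^ 4 * q ^ 2 = 82 * d * n / q ^ 2]. *)
  have gE t' : dotv (b *: g t') (normalize (b *: g t)) ^+ 4 =
      b ^+ 4 / q ^+ 2 * dotv (g t') (g t) ^+ 4.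
    rewrite dotv_normalize4 !dotvZl !dotvZr dotv_graph_diag // -/q.
    by field; rewrite !gt_eqF.
  rewrite (eq_bigr _ (fun t' _ => gE t')) -mulr_sumr.
  apply: (@le_trans _ _ (b ^+ 4 / q ^+ 2 * (82 * q ^+ 4))).
    rewrite ler_wpM2l ?sum_dotv_graph4_le //.
    by rewrite mulr_ge0 ?invr_ge0 ?exprn_ge0 // ltW.
  rewrite mulrCA mulrAC b4 mulrA ler_pdivrMr ?exprn_gt0 //.
  have dq' : d%:R <= 4 * q ^+ 2 by rewrite -natrX -natrM ler_nat.
  nra.
- exists (flat_vec R pos); split; first exact: unit_flat_vec.
  rewrite fm sumE -/N mulrC ler_pdivlMr //.
  under eq_bigr do rewrite dotvZl dotv_graph_flat // mulr1.
  rewrite sumr_const card_cubic -(mulr_natr (b ^+ 4)) natrX b4 lerDl.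
  by rewrite mulr_ge0 // dotv_extra_vec embedE // expr0n.
Qed.
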